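(* Let $(X,\mu)$ be a probability space, $T:X\to X$ a measure preserving transformation, $\mathcal{A}=\{A_i\}_{i\in\mathbb{N}}$ a measurable partition of $X$, and $g:\mathbb{N}\to[0,\infty)$ a function with $g(N)=o(N)$ such that $$\sum_{n=0}^N\left(\frac{\mu(A_i\cap T^{-n}A_j)}{\mu (A_i)\mu (A_j)}-1\right)\le g(N)\quad\text{for all } i,j,N\in\mathbb{N}.$$ Let $\{f_n\}_{n\in\mathbb{N}}$ be a sequence of non-negative functions in $\mathrm{L}^2(X,\mu)$, measurable with respect to (the $\sigma$-algebra generated by) $\mathcal{A}$, and for each $N\in\mathbb{N}$ let $$F_1(N)=\int_X\sum_{n=1}^Nf_n\,d\mu,\quad F_2(N)=\int_X\left(\sum_{n=1}^Nf_n\right)^2d\mu,$$ $$G(N)=\sum_{n=1}^Ng(n),\quad\text{and}\quad F_3(N)=F_1(N)^2(N+G(N))+F_2(N).$$ If $$(N+1)F_1(N+1)-NF_1(N)\ll F_3(N+1)-F_3(N)\ll F_3(N)^{2/3},$$ then for any $\epsilon>0$ and for $\mu$-a.e. $x\in X$ we have that $$\sum_{m=0}^{N-1}\sum_{n=1}^Nf_n(T^mx)=NF_1(N)+O_\epsilon\left(F_3(N)^{2/3}\log^{1/3+\epsilon} F_3(N)\right).$$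
   Context: $\mathbb{N}=\{1,2,\dots\}$. The displayed inequality involving $g$ is understood for those $i,j$ with $\mu(A_i),\mu(A_j)>0$. $\log^a u$ means $(\log u)^a$. $u(N)\ll v(N)$ means $|u(N)|\le C\,v(N)$ with a constant $C$ independent of $N$. The pointwise almost-everywhere estimate is understood as $N\to\infty$: for a.e. fixed $x$, the implied constant in $O_\epsilon$ does not depend on $N$ but may depend on $\epsilon$, on $x$, and on the data $X,\mu,T,\mathcal{A},g,\{f_n\}$. *)

(* Defs.v *)
From HB Require Import structures.
From mathcomp Require Export all_boot all_order all_algebra.
From mathcomp Require Export all_classical all_reals all_analysis.
Set Implicit Arguments.
Unset Strict Implicit.
Unset Printing Implicit Defensive.
Import Order.TTheory GRing.Theory Num.Theory.
Import numFieldNormedType.Exports.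
Local Open Scope classical_set_scope.
Local Open Scope ring_scope.

(* The natural numbers {1, 2, ...}.  Families indexed by it are functions on
   [nat] whose value at 0 is never used. *)
Definition posnat : set nat := [set n | (0 < n)%N].

(* Some A i may be empty, so finite partitions are covered. *)
Definition measurable_partition (d : measure_display) (X : measurableType d)
    (A : nat -> set X) : Prop :=
  [/\ forall i, posnat i -> measurable (A i),
      trivIset posnat A & \bigcup_(i in posnat) A i = setT].

(* T need not be invertible. *)
Definition measure_preserving (d : measure_display) (X : measurableType d)
    (R : realType) (mu : probability X R) (T : X -> X) : Prop :=
  measurable_fun setT T /\
  forall B : set X, measurable B -> mu (T @^-1` B) = mu B.

Definition partition_measurable (d : measure_display) (X : measurableType d)
    (R : realType) (A : nat -> set X) (f : X -> R) : Prop :=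
  @measurable_fun _ _ (g_sigma_algebraType (A @` posnat)) R setT f.

Definition vinogradov (R : realType) (u v : nat -> R) : Prop :=
  exists C : R, forall N : nat, posnat N -> `|u N| <= C * v N.

Section moments.
Context (d : measure_display) (X : measurableType d) (R : realType).
Variables (mu : probability X R) (g : nat -> R) (f : nat -> X -> R).

Definition F1 (N : nat) : R :=
  \int[mu]_x (\sum_(1 <= n < N.+1) f n x).

Definition F2 (N : nat) : R :=
  \int[mu]_x ((\sum_(1 <= n < N.+1) f n x) ^+ 2).

Definition G (N : nat) : R := \sum_(1 <= n < N.+1) g n.

Definition F3 (N : nat) : R := F1 N ^+ 2 * (N%:R + G N) + F2 N.

End moments.

(* Main.v *)
(* With h = f_1 + ... + f_N constant on the parts and S_M = h + ... + h o T^(M-1),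
   expanding over pairs of parts turns the mixing hypothesis into
   E[h S_(M+1)] <= (g(M) + M + 1) F1(N)^2, and S_(M+1) = h + S_M o T then gives
   E[(S_N - N F1(N))^2] <= 2 F3(N).  If F1 vanishes identically, the left-hand side
   is a.e. 0; otherwise F3 -> oo.  Choose N_(j+1) as the first index at which F3
   exceeds F3(N_j) by F3(N_j)^(2/3) log^(1/3) F3(N_j): then
   sum_j F3(N_j) / (F3(N_j)^(2/3) log^(1/3+eps) F3(N_j))^2 is bounded by a
   telescoping sum, so the deviations at the N_j are a.e. of the required size.
   Between N_j and N_(j+1) one uses that S_N increases with N, and that
   N F1(N) grows by at most a constant times the increment of F3. *)
Require Import Defs.
From mathcomp Require Import measurable_realfun.
From mathcomp Require Import ring lra zify.
Set Implicit Arguments.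
Unset Strict Implicit.
Unset Printing Implicit Defensive.
Import Order.TTheory GRing.Theory Num.Theory.
Import numFieldNormedType.Exports.
Local Open Scope classical_set_scope.
Local Open Scope ring_scope.

(** * Functions measurable with respect to a partition *)

(* The sets that contain or avoid each part form a sigma-algebra. *)
Lemma partition_measurable_const d (X : measurableType d) (R : realType)
    (A : nat -> set X) (f : X -> R) :
  measurable_partition A -> partition_measurable A f ->
  forall i x y, posnat i -> A i x -> A i y -> f x = f y.
Proof.
move=> [_ tA cA] fm i x y i0 Aix Aiy.
pose S := [set B : set X | forall i, posnat i -> A i `<=` B \/ A i `<=` ~` B].
have SA : <<s A @` posnat >> `<=` S.
  apply: smallest_sub.
    split=> [j j0|B SB j j0|F SF j j0]; first by right; rewrite setC0.
      by rewrite setTD setCK; case: (SB j j0); [right|left].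
    have [[n AF]|nAF] := pselect (exists n, A j `<=` F n).
      by left=> z /AF Fz; exists n.
    right=> z Az [n _ Fz]; case: (SF n j j0) => AF; first by apply: nAF; exists n.
    exact: AF Az Fz.
  move=> _ [j j0 <-] k k0; have [->|jk] := eqVneq j k; first by left.
  right=> z Akz Ajz; move/eqP: jk; apply; apply: tA => //; by exists z.
(* The level set of [f] through [x] meets the part at [x], so it cannot avoid that part and must
   contain [y]. *)
have : S (f @^-1` [set f x]).
  apply: SA; rewrite -[_ @^-1` _]setTI.
  exact: (fm measurableT [set f x] (measurable_set1 _)).
by move=> /(_ i i0)[/(_ _ Aiy)//|/(_ _ Aix)]; case.
Qed.

(** * Integration of functions constant on each part *)

Section step_functions.
Context d (X : measurableType d) (R : realType) (mu : {measure set X -> \bar R}).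
Variables (B : nat -> set X) (c : nat -> R) (h : X -> R).
Hypotheses (mB : forall i, measurable (B i)) (tB : trivIset setT B)
  (cB : \bigcup_i B i = setT) (c_ge0 : forall i, 0 <= c i)
  (hB : forall i x, B i x -> h x = c i).

Local Open Scope ereal_scope.

Lemma step_ge0 x : (0 <= h x)%R.
Proof. by have: setT x by []; rewrite -cB => -[i _ /hB ->]. Qed.

(** Countable additivity over the parts, with the constant [c i] pulled out on [B i]. The factor [u]
    will be a Birkhoff sum of [h], or [1] to compute the integral of [h] alone. *)
Lemma integral_step_mul (D : set X) (u : X -> \bar R) :
  measurable_fun setT h ->
  measurable D -> measurable_fun setT u -> (forall x, 0 <= u x) ->
  \int[mu]_(x in D) ((h x)%:E * u x) =
  \sum_(i <oo) (c i)%:E * \int[mu]_(x in D `&` B i) u x.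
Proof.
move=> mh mD mu_ u0; rewrite -[in LHS](setIT D) -cB setI_bigcupr.
rewrite ge0_integral_bigcup//.
- apply: eq_eseriesr => i _; rewrite -ge0_integralZl_EFin//.
    by apply: eq_integral => x /set_mem[_ /hB ->].
    by apply: measurableI.
    by apply: measurable_funTS.
- by move=> k; apply: measurableI.
- apply: measurable_funTS; apply: emeasurable_funM => //.
  exact/measurable_EFinP.
- by move=> x _; rewrite mule_ge0// lee_fin step_ge0.
- exact/trivIset_setIl.
Qed.

Lemma integral_step (D : set X) :
  measurable_fun setT h ->
  measurable D ->
  \int[mu]_(x in D) (h x)%:E = \sum_(i <oo) (c i)%:E * mu (D `&` B i).
Proof.
move=> mh mD; have := @integral_step_mul D (cst 1) mh mD.
under eq_integral do rewrite mule1.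
move=> ->//.
apply: eq_eseriesr => i _; rewrite integral_cst ?mul1e//. exact: measurableI.
Qed.

End step_functions.

(** * Measure-preserving maps and Birkhoff sums *)

Section measure_preserving.
Context d (X : measurableType d) (R : realType) (mu : probability X R).
Variable (T : X -> X).
Hypothesis hT : measure_preserving mu T.

Lemma measure_preserving_iter n : measure_preserving mu (iter n T).
Proof.
have [mT pT] := hT; elim: n => [|n [mI pI]] /=.
  by split=> //; exact: measurable_id.
split; first exact: measurableT_comp.
move=> C mC; rewrite (_ : _ @^-1` _ = iter n T @^-1` (T @^-1` C))//.
by rewrite pI ?pT//; rewrite -[X in measurable X]setTI; exact: mT.
Qed.

Lemma integral_measure_preserving (u : X -> \bar R) : measurable_fun setT u ->
  (forall x, 0 <= u x)%E -> (\int[mu]_x u (T x) = \int[mu]_x u x)%E.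
Proof.
have [mT pT] := hT => mu_ u0.
have := @ge0_integral_pushforward _ _ _ _ R T mT mu setT u measurableT mu_.
rewrite preimage_setT => <- //; apply: eq_measure_integral => C mC _; exact: pT.
Qed.

End measure_preserving.

Definition birkhoff (R : realType) (X : Type) (T : X -> X) (h : X -> R) (M : nat)
  (x : X) : R := \sum_(0 <= m < M) h (iter m T x).

(** The first term is split off rather than the last: the remainder is then the previous sum
    composed with [T], whose moments are unchanged by invariance. *)
Lemma birkhoffS (R : realType) (X : Type) (T : X -> X) (h : X -> R) M x :
  birkhoff T h M.+1 x = h x + birkhoff T h M (T x).
Proof.
rewrite /birkhoff big_nat_recl//=; congr (_ + _).
by apply: eq_bigr => k _; rewrite -iterS iterSr.
Qed.

Section birkhoff_measurable.
Context d (X : measurableType d) (R : realType) (mu : probability X R).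
Variables (T : X -> X) (h : X -> R).
Hypothesis (hT : measure_preserving mu T) (mh : measurable_fun setT h)
  (h_ge0 : forall x, 0 <= h x).

Lemma measurable_comp_iter k : measurable_fun setT (fun x => h (iter k T x)).
Proof. exact: measurableT_comp (measure_preserving_iter hT k).1. Qed.

Lemma measurable_birkhoff M : measurable_fun setT (birkhoff T h M).
Proof. by apply: measurable_sum => k; exact: measurable_comp_iter. Qed.

Lemma birkhoff_ge0 M x : 0 <= birkhoff T h M x.
Proof. by apply: sumr_ge0. Qed.

Lemma integral_birkhoff M e : (\int[mu]_x (h x)%:E = e%:E)%E ->
  (\int[mu]_x (birkhoff T h M x)%:E = (M%:R * e)%:E)%E.
Proof.
move=> he.
have Ik k : (\int[mu]_x (h (iter k T x))%:E = e%:E)%E.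
  rewrite -he; apply: (integral_measure_preserving (measure_preserving_iter hT k)
    (u := EFin \o h)); first exact/measurable_EFinP.
  by move=> x; rewrite lee_fin.
under eq_integral do rewrite /birkhoff -sumEFin.
rewrite ge0_integral_sum//=; last 2 first.
- by move=> k; apply/measurable_EFinP; exact: measurable_comp_iter.
- by move=> k x _; rewrite lee_fin.
under eq_bigr do rewrite Ik.
by rewrite sumEFin big_const_nat subn0 iter_addr_0 mulr_natl.
Qed.

End birkhoff_measurable.

(** * Correlations summed over pairs of parts *)

Section correlation.
Context d (X : measurableType d) (R : realType) (mu : probability X R).
Variables (T : X -> X) (B : nat -> set X) (c : nat -> R) (h : X -> R).
Hypothesis (hT : measure_preserving mu T).
Hypotheses (mB : forall i, measurable (B i)) (tB : trivIset setT B)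
  (cB : \bigcup_i B i = setT) (c_ge0 : forall i, 0 <= c i)
  (hB : forall i x, B i x -> h x = c i) (mh : measurable_fun setT h).

Local Open Scope ereal_scope.

(** First half of the expansion over pairs: [D] stands for one fixed part, and the sum over times is
    bounded separately against each part [B j]. *)
Lemma integral_birkhoff_on_le (M : nat) (K e : R) (D : set X) : (0 <= K)%R ->
  measurable D -> \int[mu]_x (h x)%:E = e%:E ->
  (forall j, \sum_(0 <= k < M) mu (D `&` iter k T @^-1` B j) <=
     K%:E * (mu D * mu (B j))) ->
  \int[mu]_(x in D) (birkhoff T h M x)%:E <= (K * e)%:E * mu D.
Proof.
move=> K0 mD he corr; have h0 := step_ge0 cB c_ge0 hB.
have mI k := (measure_preserving_iter hT k).1.
have mTB k j : measurable (iter k T @^-1` B j).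
  by rewrite -[X in measurable X]setTI; exact: mI.
under eq_integral do rewrite /birkhoff -sumEFin.
rewrite ge0_integral_sum//=; last 2 first.
- move=> k; apply/measurable_EFinP; apply: measurable_funTS.
  exact: (measurable_comp_iter hT mh).
- by move=> k x _; rewrite lee_fin.
under eq_bigr => k _.
  (* [h] composed with [iter k T] is again a step function, with the same constants, on the
     pulled-back partition. *)
  rewrite (@integral_step _ _ _ mu (fun j => iter k T @^-1` B j) c
    (fun x => h (iter k T x)))//; last 4 first.
  - by move=> i j _ _ [x [/= Bi Bj]]; apply: tB => //; exists (iter k T x).
  - by rewrite -preimage_bigcup cB.
  - by move=> j x /hB.
  - exact: (measurable_comp_iter hT mh).
  over.
rewrite -nneseries_sum_nat; last first.
  by move=> k j; rewrite mule_ge0// lee_fin.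
(* The right-hand side is written as a series over the same index [j], so that the comparison is
   termwise. *)
have -> : (K * e)%:E * mu D =
    \sum_(j <oo) (K * fine (mu D))%:E * ((c j)%:E * mu (B j)).
  rewrite nneseriesZl; last by move=> i _; rewrite mule_ge0// lee_fin.
  have <- : \int[mu]_x (h x)%:E = \sum_(i <oo) (c i)%:E * mu (B i).
    rewrite (integral_step mu mB tB cB c_ge0 hB mh measurableT).
    by apply: eq_eseriesr => i _; rewrite setTI.
  by rewrite he !EFinM fineK ?fin_num_measure// -!muleA; congr (_ * _); rewrite muleC.
apply: lee_nneseries => [j _ _|j _].
  by apply: sume_ge0 => k _; rewrite mule_ge0// lee_fin.
rewrite -ge0_sume_distrr//; apply: le_trans (lee_wpmul2l _ (corr j)) _.
  by rewrite lee_fin.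
by rewrite EFinM fineK ?fin_num_measure// muleCA -!muleA [mu D * (_ * _)]muleCA.
Qed.

(** Second half of the expansion: the outer factor [h] is split along the parts, and the previous
    bound is applied with [D] equal to each [B i]. *)
Lemma integral_mul_birkhoff_le (M : nat) (K e : R) : (0 <= K)%R ->
  \int[mu]_x (h x)%:E = e%:E ->
  (forall i j, \sum_(0 <= k < M) mu (B i `&` iter k T @^-1` B j) <=
     K%:E * (mu (B i) * mu (B j))) ->
  \int[mu]_x (h x * birkhoff T h M x)%:E <= (K * e ^+ 2)%:E.
Proof.
move=> K0 he corr; have h0 := step_ge0 cB c_ge0 hB.
under eq_integral do rewrite EFinM.
rewrite (integral_step_mul mu mB tB cB c_ge0 hB mh measurableT); last 2 first.
- by apply/measurable_EFinP; exact: (measurable_birkhoff hT mh).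
- by move=> x; rewrite lee_fin birkhoff_ge0.
have -> : (K * e ^+ 2)%:E = \sum_(i <oo) (K * e)%:E * ((c i)%:E * mu (B i)).
  rewrite nneseriesZl; last by move=> i _; rewrite mule_ge0// lee_fin.
  have <- : \int[mu]_x (h x)%:E = \sum_(i <oo) (c i)%:E * mu (B i).
    rewrite (integral_step mu mB tB cB c_ge0 hB mh measurableT).
    by apply: eq_eseriesr => i _; rewrite setTI.
  by rewrite he -EFinM expr2 mulrA.
apply: lee_nneseries => [i _ _|i _]; rewrite setTI.
  rewrite mule_ge0 ?lee_fin//; apply: integral_ge0 => x _.
  by rewrite lee_fin birkhoff_ge0.
rewrite muleCA; apply: lee_wpmul2l; first by rewrite lee_fin.
exact: integral_birkhoff_on_le.
Qed.

End correlation.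

(** * Second moment and variance of Birkhoff sums *)

Section variance.
Context d (X : measurableType d) (R : realType) (mu : probability X R).
Variables (T : X -> X) (h : X -> R).
Hypothesis (hT : measure_preserving mu T) (mh : measurable_fun setT h)
  (h_ge0 : forall x, 0 <= h x).

Local Open Scope ereal_scope.

(* For [h >= 0], [S_{N+1} = h + S_N o T] gives
   [S_{N+1}^2 <= 2 h S_{N+1} + (S_N o T)^2]. *)
Lemma integral_birkhoff_sqr_le (b : nat -> R) :
  (forall M, \int[mu]_x (h x * birkhoff T h M.+1 x)%:E <= (b M)%:E) ->
  forall N, \int[mu]_x ((birkhoff T h N x) ^+ 2)%:E <=
    (2 * \sum_(0 <= M < N) b M)%:E.
Proof.
move=> hb; have mB N := measurable_birkhoff hT mh N.
have B0 N x := birkhoff_ge0 T h_ge0 N x.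
elim=> [|N IH].
  under eq_integral do rewrite /birkhoff big_geq// expr0n/=.
  by rewrite integral0 big_geq// mulr0.
pose u x := 2%:E * (h x * birkhoff T h N.+1 x)%:E.
pose v x := ((birkhoff T h N x) ^+ 2)%:E : \bar R.
have mhB : measurable_fun setT (fun x => (h x * birkhoff T h N.+1 x)%:E).
  by apply/measurable_EFinP/measurable_funM.
have mv : measurable_fun setT v by apply/measurable_EFinP/measurable_funX.
have mu_ : measurable_fun setT u by apply: measurable_funeM.
have hB0 x : 0 <= (h x * birkhoff T h N.+1 x)%:E by rewrite lee_fin mulr_ge0.
have v0 x : 0 <= v x by rewrite lee_fin sqr_ge0.
have u0 x : 0 <= u x by rewrite mule_ge0.
have mvT : measurable_fun setT (v \o T) by apply: measurableT_comp => //; exact: hT.1.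
apply: (@le_trans _ _ (\int[mu]_x (u x + v (T x)))).
  apply: ge0_le_integral => //.
  - by move=> x _; rewrite lee_fin sqr_ge0.
  - by apply/measurable_EFinP/measurable_funX.
  - exact: emeasurable_funD.
  - move=> x _; rewrite /u /v -EFinM -EFinD lee_fin birkhoffS.
    have := h_ge0 x; have := B0 N (T x); nra.
rewrite ge0_integralD//.
rewrite (integral_measure_preserving hT mv v0) ge0_integralZl_EFin//.
by rewrite big_nat_recr//= mulrDr [leRHS]EFinD addeC leeD// EFinM lee_wpmul2l// hb.
Qed.

Lemma integral_birkhoff_var_le (b : nat -> R) (e : R) :
  \int[mu]_x (h x)%:E = e%:E ->
  (forall M, \int[mu]_x (h x * birkhoff T h M.+1 x)%:E <= (b M)%:E) ->
  forall N, \int[mu]_x ((birkhoff T h N x - N%:R * e) ^+ 2)%:E <=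
    (2 * (\sum_(0 <= M < N) b M) - (N%:R * e) ^+ 2)%:E.
Proof.
move=> he hb N; have mB := measurable_birkhoff hT mh N.
have B0 x := birkhoff_ge0 T h_ge0 N x.
have e0 : (0 <= N%:R * e)%R.
  rewrite mulr_ge0// -lee_fin -he integral_ge0// => x _; exact: h_ge0.
set m := (N%:R * e)%R in e0 *.
have mBE : measurable_fun setT (fun x => (birkhoff T h N x)%:E).
  exact/measurable_EFinP.
have BE0 x : setT x -> 0 <= (birkhoff T h N x)%:E by rewrite lee_fin.
have sq0 (y : R) : 0 <= (y ^+ 2)%:E by rewrite lee_fin sqr_ge0.
(* The expanded square is arranged with nonnegative terms on both sides, so additivity for
   nonnegative functions applies without knowing that the square is integrable. *)
have split_sq : \int[mu]_x ((birkhoff T h N x - m) ^+ 2)%:E +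
    (2 * m)%:E * m%:E = \int[mu]_x ((birkhoff T h N x) ^+ 2)%:E + (m ^+ 2)%:E.
  rewrite -[X in _ * X](integral_birkhoff hT mh h_ge0 N he).
  rewrite -ge0_integralZl_EFin//; last exact: mulr_ge0.
  rewrite -[X in _ = _ + X]mule1 -(@probability_setT _ _ _ mu) -integral_cst//.
  rewrite -!ge0_integralD//.
  - by apply: eq_integral => x _ /=; rewrite -EFinM -!EFinD; congr EFin; ring.
  - exact/measurable_EFinP/measurable_funX.
  - by move=> x _; exact: sq0.
  - by apply/measurable_EFinP/measurable_funX; exact: measurable_funB.
  - by move=> x _; rewrite mule_ge0 ?BE0// lee_fin mulr_ge0.
  - exact: measurable_funeM.
rewrite -(leeD2rE (x := (2 * m)%:E * m%:E))// split_sq.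
have := integral_birkhoff_sqr_le hb N => H.
apply: le_trans (leeD2r _ H) _.
by rewrite -EFinM -!EFinD lee_fin; lra.
Qed.

End variance.

(** * Real estimates for the spacing and the error rate *)

Section rates.
Variable R : realType.
Implicit Types a b s u v p eps t : R.

(** From [ln y <= y - 1] at [y = 1 / (1 + s)]: this gives [ln (1 + s) >= s / (1 + s)], and
    [1 + s <= 2]. *)
Lemma ln1D_ge s : 0 <= s <= 1 -> s / 2 <= ln (1 + s).
Proof.
move=> /andP[s0 s1].
have s1gt : 0 < 1 + s by lra.
have := @le_ln1Dx _ ((1 + s)^-1 - 1).
rewrite (addrC 1 (_ - 1)) subrK lnV ?posrE// => /(_ _)/wrap[].
  by rewrite ltrBrDr addNr invr_gt0.
rewrite lerNl => /(le_trans _); apply.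
rewrite opprB lerBrDr -lerBrDl -(mul1r _^-1) ler_pdivrMr//; nra.
Qed.

(** A mean value estimate for the power [- p]. After factoring out [(u + delta)] to that power, the
    exponential inequality gives [(1 + delta / u)]^ p >= 1 + p * (delta / u / 2)[, and]u + delta <=
    2 * u[accounts for the factor]2 [^ (- p)]. *)
Lemma powRN_sub_ge u v delta p : 0 < p -> 0 < u -> 0 <= delta <= u ->
  u + delta <= v ->
  p * 2 `^ (- p) * (delta / u / 2) * u `^ (- p) <= u `^ (- p) - v `^ (- p).
Proof.
move=> p0 u0 /andP[d0 du] uv.
have x1 : 0 <= delta / u <= 1.
  by rewrite divr_ge0 ?(ltW u0)//= ler_pdivrMr// mul1r.
have le_inv x y : 0 < x -> x <= y -> y `^ (- p) <= x `^ (- p).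
  move=> x0 xy; have y0 := lt_le_trans x0 xy.
  rewrite !powRN lef_pV2 ?posrE ?powR_gt0//.
  by apply: ge0_ler_powR => //; rewrite ?nnegrE ltW.
have ud0 : 0 < u + delta by lra.
have E : u `^ (- p) = (u + delta) `^ (- p) * (1 + delta / u) `^ p.
  have -> : u + delta = u * (1 + delta / u) by field; rewrite gt_eqF.
  rewrite powRM ?(ltW u0)//; last by lra.
  by rewrite -mulrA (powRN (1 + _)) mulVf ?mulr1// gt_eqF// powR_gt0; lra.
have E1 : 1 + p * (delta / u / 2) <= (1 + delta / u) `^ p.
  rewrite /powR gt_eqF; last by lra.
  apply: le_trans (expR_ge1Dx _); rewrite lerD2l ler_pM2l//.
  exact: ln1D_ge.
apply: le_trans (_ : u `^ (- p) - (u + delta) `^ (- p) <= _); last first.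
  by rewrite lerD2l lerN2 le_inv.
have E2 : 2 `^ (- p) * u `^ (- p) <= (u + delta) `^ (- p).
  rewrite -powRM ?(ltW u0)// le_inv//; lra.
have P0 : 0 <= p * (delta / u / 2) by rewrite mulr_ge0 ?(ltW p0)//; lra.
apply: le_trans (_ : (u + delta) `^ (- p) * (p * (delta / u / 2)) <= _).
  have -> : p * 2 `^ (- p) * (delta / u / 2) * u `^ (- p) =
    (2 `^ (- p) * u `^ (- p)) * (p * (delta / u / 2)).
    by field; rewrite gt_eqF.
  exact: ler_wpM2r.
rewrite E -[X in _ <= _ - X]mulr1 -mulrBr.
by apply: ler_wpM2l; [exact: powR_ge0|lra].
Qed.

(** The spacing imposed on the values of [F3] along the subsequence. It has the form of [rate] with
    [eps = 0]: small enough to be absorbed in the error, large enough for the deviations to be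
    summable. *)
Definition gap t : R := t `^ (2 / 3) * ln t `^ (1 / 3).

Definition rate eps t : R := t `^ (2 / 3) * ln t `^ (1 / 3 + eps).

(** This is why the threshold [expR 1] recurs: beyond it, powers of [ln t] are at least those with a
    smaller exponent, and [rate] is positive. *)
Lemma ln_ge1 t : expR 1 <= t -> 1 <= ln t.
Proof.
move=> et; rewrite -(expRK 1) ler_ln// posrE ?expR_gt0//.
exact: lt_le_trans (expR_gt0 _) et.
Qed.

Lemma expR1_gt0 t : expR 1 <= t -> 0 < t.
Proof. exact: lt_le_trans (expR_gt0 _). Qed.

Lemma rate_gt0 eps t : expR 1 <= t -> 0 < rate eps t.
Proof.
move=> et; rewrite mulr_gt0// powR_gt0 ?(expR1_gt0 et)//.
exact: lt_le_trans ltr01 (ln_ge1 et).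
Qed.

Lemma gap_le_rate eps t : 0 <= eps -> expR 1 <= t -> gap t <= rate eps t.
Proof.
move=> e0 et; apply: ler_wpM2l; first exact: powR_ge0.
by apply: ler_powR; [exact: ln_ge1|lra].
Qed.

Lemma le_rate eps a b : 0 <= eps -> expR 1 <= a -> a <= b ->
  rate eps a <= rate eps b.
Proof.
move=> e0 ea ab; have eb := le_trans ea ab.
have := ln_ge1 ea; have := ln_ge1 eb; have := expR1_gt0 ea.
have := expR1_gt0 eb => b0 a0 lb la.
apply: ler_pM; rewrite ?powR_ge0//.
  by apply: ge0_ler_powR => //; rewrite ?nnegrE; lra.
apply: ge0_ler_powR; rewrite ?nnegrE//; try lra.
by rewrite ler_ln.
Qed.

(** Since [ln t >= 1], [ln (c * t) = ln c + ln t <= (1 + ln c) * ln t]. This compares the rates at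
    the two ends of a block. *)
Lemma rateM_le eps c t : 0 <= eps -> 1 <= c -> expR 1 <= t ->
  rate eps (c * t) <= c `^ (2 / 3) * (1 + ln c) `^ (1 / 3 + eps) * rate eps t.
Proof.
move=> e0 c1 et; have t0 := expR1_gt0 et; have lt1 := ln_ge1 et.
have c0 : 0 < c by lra.
have lc := ln_ge0 c1.
rewrite /rate powRM ?(ltW c0) ?(ltW t0)// mulrACA; apply: ler_wpM2l.
  by rewrite mulr_ge0// powR_ge0.
rewrite -powRM//; try lra.
apply: ge0_ler_powR; rewrite ?nnegrE ?lnM ?posrE//; try lra.
by rewrite mulr_ge0//; lra.
nra.
Qed.

Lemma gap_ge t : expR 1 <= t -> t `^ (2 / 3) <= gap t.
Proof.
move=> et; rewrite -{1}(mulr1 (t `^ _)); apply: ler_wpM2l; first exact: powR_ge0.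
rewrite -[leLHS](powRr0 (ln t)); apply: ler_powR; [exact: ln_ge1|lra].
Qed.

Lemma gap_le t : expR 1 <= t -> gap t <= t.
Proof.
move=> et; have t0 := expR1_gt0 et; have lt1 := ln_ge1 et.
have tE : t `^ (2 / 3) * t `^ (1 / 3) = t.
  rewrite -powRD; last by rewrite (gt_eqF t0) implybT.
  by rewrite (_ : 2 / 3 + 1 / 3 = 1) ?powRr1 ?(ltW t0)//; field.
rewrite -[leRHS]tE; apply: ler_wpM2l; first exact: powR_ge0.
apply: ge0_ler_powR; rewrite ?nnegrE; try lra.
exact/ltW/ln_sublinear.
Qed.

(* [1 / (t ln^(1 + 2 eps) t)] is the derivative of [- ln^(- 2 eps) t / (2 eps)]
   and [t / rate eps t ^ 2] is [gap t] times it, so these terms telescope along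
   a sequence whose consecutive values are at least [gap] apart. *)
Lemma div_rate_sqr_le eps a b : 0 < eps -> expR 1 <= a -> a + gap a <= b ->
  a / rate eps a ^+ 2 <= 2 * 2 `^ (2 * eps) / eps *
    (ln a `^ (- (2 * eps)) - ln b `^ (- (2 * eps))).
Proof.
move=> e0 ea ab; have a0 := expR1_gt0 ea; have u1 := ln_ge1 ea.
have u0 : 0 < ln a by lra.
have three (x y : R) : 0 < x -> x `^ (y + (y + y)) = (x `^ y) ^+ 3.
  move=> x0; rewrite !powRD ?exprS ?expr0 ?mulr1//;
  by apply/implyP => _; rewrite gt_eqF.
(* In terms of these roots all the powers involved become rational expressions, which [field] can
   handle. *)
pose A := a `^ (1 / 3); pose U := ln a `^ (1 / 3); pose E := ln a `^ eps.
have A0 : 0 < A by exact: powR_gt0.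
have U0 : 0 < U by exact: powR_gt0.
have E0 : 0 < E by exact: powR_gt0.
have thirds : 1 / 3 + (1 / 3 + 1 / 3) = 1 :> R by field.
have aA : a = A ^+ 3 by rewrite -three// thirds powRr1// ltW.
have uU : ln a = U ^+ 3 by rewrite -three// thirds powRr1// ltW.
have a23 : a `^ (2 / 3) = A ^+ 2.
  by rewrite -powR_mulrn ?powR_ge0// -powRrM; congr powR; field.
have u23 : ln a `^ (1 / 3 + eps) = U * E.
  by rewrite powRD//; apply/implyP => _; rewrite gt_eqF.
have up : ln a `^ (- (2 * eps)) = (E ^+ 2)^-1.
  by rewrite powRN -powR_mulrn ?powR_ge0// -powRrM mulrC.
(* [s] is the relative spacing [gap a / a]; hence [b >= a * (1 + s)], and [ln] grows by at least
   [s / 2] from [a] to [b]. *)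
pose s := U / A.
have gapE : gap a = a * s.
  by rewrite /gap a23 -/U {1}aA /s; field; rewrite gt_eqF.
have s01 : 0 <= s <= 1.
  rewrite divr_ge0 ?(ltW U0) ?(ltW A0)//= -(ler_pM2l a0) mulr1 -gapE; exact: gap_le.
have b0 : 0 < b by apply: lt_le_trans ab; rewrite gapE; nra.
have lns : ln a + ln (1 + s) <= ln b.
  rewrite -lnM ?posrE//; last by lra.
  rewrite ler_ln ?posrE ?mulr_gt0//; try lra.
have d0 : s / 2 <= ln (1 + s) by exact: ln1D_ge.
have d1 : s / 2 <= ln a by lra.
have p0 : 0 < 2 * eps by lra.
have hd : 0 <= s / 2 <= ln a by lra.
have hv : ln a + s / 2 <= ln b by lra.
have := powRN_sub_ge p0 u0 hd hv.
rewrite up (powRN 2); set D := _ - _ => H.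
have P0 : 0 < 2 `^ (2 * eps) :> R by exact: powR_gt0.
rewrite -ler_pdivrMl; last by rewrite divr_gt0// mulr_gt0.
(* The constant in the statement is the exact reciprocal of the one produced by [powRN_sub_ge] with
   [p = 2 * eps] and [delta = s / 2], so equality holds here. *)
apply: le_trans H; rewrite /rate a23 u23 uU {1}aA /s le_eqVlt; apply/orP; left.
by apply/eqP; field; rewrite !gt_eqF.
Qed.

End rates.

(** * Sparse subsequences and interpolation between their terms *)

(** Each index is the first at which [Phi] has gained [sigma] over its previous value. Minimality
    gives the last clause: one index earlier the gain is not yet reached. *)
Lemma sparse_subsequence (R : realType) (Phi : nat -> R) (t0 : R) (sigma : R -> R) :
  {homo Phi : m n / (m <= n)%N >-> m <= n} ->
  (forall M, exists n, M <= Phi n) -> (forall t, t0 <= t -> 0 < sigma t) ->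
  exists N : nat -> nat, [/\ (0 < N 0)%N, forall j, (N j < N j.+1)%N,
    forall j, t0 <= Phi (N j),
    forall j, Phi (N j) + sigma (Phi (N j)) <= Phi (N j.+1) &
    forall j, Phi (N j.+1).-1 < Phi (N j) + sigma (Phi (N j))].
Proof.
move=> Phi_homo Phi_unb sigma_gt0.
have next_ex m : exists k, Phi m + sigma (Phi m) <= Phi k /\
    forall i, Phi m + sigma (Phi m) <= Phi i -> (k <= i)%N.
  by case: (ex_minnP (Phi_unb (Phi m + sigma (Phi m)))) => k; exists k.
have [nxt nxtP] := choice next_ex.
have [n0 n0P] := Phi_unb t0.
(* Starting at a successor makes every index of the subsequence positive. *)
have n1P : t0 <= Phi n0.+1 by apply: le_trans n0P _; exact: Phi_homo.
have nxt_gt m : t0 <= Phi m -> (m < nxt m)%N.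
  move=> tm; rewrite ltnNge; apply/negP => /Phi_homo.
  have [+ _] := nxtP m; have := sigma_gt0 _ tm; lra.
pose N j := iter j nxt n0.+1.
have NP j : t0 <= Phi (N j).
  elim: j => [//|j IH] /=; apply: le_trans (IH) _; apply: Phi_homo.
  exact: ltnW (nxt_gt _ IH).
exists N; split => // [j|j|j]; first exact: nxt_gt.
  by have [] := nxtP (N j).
have [_ H] := nxtP (N j); rewrite ltNge; apply/negP => /H.
rewrite -ltnS prednK ?ltnn//; exact: leq_ltn_trans (nxt_gt _ (NP j)).
Qed.

Lemma between_subsequence (N : nat -> nat) : (forall j, (N j < N j.+1)%N) ->
  forall n, (N 0 <= n)%N -> exists j, (N j <= n < N j.+1)%N.
Proof.
move=> N_lt; elim=> [|n IH] hn; first by exists 0%N; have := N_lt 0%N; lia.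
have [hn'|hn'] := leqP (N 0%N) n; last by exists 0%N; have := N_lt 0%N; lia.
have [j /andP[h1 h2]] := IH hn'.
have [h3|h3] := ltnP n.+1 (N j.+1); first by exists j; rewrite h3 ltnW.
by exists j.+1; have := N_lt j.+1; lia.
Qed.

Section interpolation.
Variables (R : realType) (Phi e : nat -> R) (eps C1 C2 : R) (N : nat -> nat).
Hypotheses (Phi_homo : {homo Phi : m n / (m <= n)%N >-> m <= n})
  (eps_gt0 : 0 < eps) (C1_ge0 : 0 <= C1) (C2_ge0 : 0 <= C2)
  (e_incr : forall n, (0 < n)%N -> `|e n.+1 - e n| <= C1 * (Phi n.+1 - Phi n))
  (Phi_incr : forall n, (0 < n)%N -> Phi n.+1 - Phi n <= C2 * Phi n `^ (2 / 3)).
Hypotheses (N0 : (0 < N 0)%N) (N_lt : forall j, (N j < N j.+1)%N)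
  (N_ge : forall j, expR 1 <= Phi (N j))
  (N_step : forall j, Phi (N j.+1).-1 < Phi (N j) + gap (Phi (N j))).

Lemma diff_le_of_incr m n : (0 < m)%N -> (m <= n)%N ->
  e n - e m <= C1 * (Phi n - Phi m).
Proof.
move=> m0; elim: n => [|n IH]; first by rewrite leqn0 => /eqP m00; rewrite m00 in m0.
rewrite leq_eqVlt => /orP[/eqP->|]; first by rewrite !subrr mulr0.
rewrite ltnS => mn; have := IH mn; have := e_incr (leq_trans m0 mn).
by rewrite ler_norml => /andP[_]; lra.
Qed.

Let N_gt0 j : (0 < N j)%N.
Proof. by elim: j => [//|j IH]; exact: ltn_trans (N_lt j). Qed.

(** Just before [N j.+1] the value is at most [Phi (N j) + gap (Phi (N j))], hence at most twice
    [Phi (N j)]. The last jump then costs at most [C2] times the power [2 / 3] of that, which is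
    within [2 * C2] gaps. *)
Let Phi_next j :
  Phi (N j.+1) <= Phi (N j) + (1 + 2 * C2) * gap (Phi (N j)).
Proof.
have ea := N_ge j; have a0 := expR1_gt0 ea.
have n0 : (N j <= (N j.+1).-1)%N by have := N_lt j; lia.
have nE : (N j.+1).-1.+1 = N j.+1 by have := N_lt j; lia.
have := Phi_incr (leq_trans (N_gt0 j) n0); rewrite nE.
have Pn := Phi_homo n0; have := N_step j.
have := gap_le ea; have := gap_ge ea.
move: Pn; set b := Phi _.-1; set a := Phi (N j) in ea a0 *; set c := Phi _.
move=> ab ga ga' bg cb.
have : b `^ (2 / 3) <= (2 * a) `^ (2 / 3).
  by apply: ge0_ler_powR; rewrite ?nnegrE; lra.
have : (2 * a) `^ (2 / 3) <= 2 * a `^ (2 / 3).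
  rewrite powRM ?(ltW a0)//; apply: ler_wpM2r; first exact: powR_ge0.
  by apply: ler1_powR; lra.
move=> h1 h2; have h3 : b `^ (2 / 3) <= 2 * gap a by lra.
have := ler_wpM2l C2_ge0 h3; lra.
Qed.

(** Inside a block, [y n] lies between the values of [y] at the two ends, while [e] varies by at
    most [C1] times the growth of [Phi] over the block, which is of the order of [gap]. *)
Lemma interpolation_bigO (y : nat -> R) (M : R) :
  {homo y : m n / (m <= n)%N >-> m <= n} ->
  (forall j, `|y (N j) - e (N j)| <= M * rate eps (Phi (N j))) ->
  (fun n => y n - e n) =O_\oo (fun n => rate eps (Phi n)).
Proof.
move=> y_homo yM.
(* [D] bounds the growth of [Phi] over a block in units of [gap], [c] the ratio of [Phi] at its
   ends, and [L] the ratio of the rates there. *)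
pose D := 1 + 2 * C2; pose c := 1 + D.
pose L := c `^ (2 / 3) * (1 + ln c) `^ (1 / 3 + eps).
have D1 : 1 <= D by rewrite /D lerDl mulr_ge0.
have c1 : 1 <= c by rewrite /c; lra.
have M0 : 0 <= M.
  have := le_trans (normr_ge0 _) (yM 0%N).
  by rewrite pmulr_lge0// rate_gt0.
have L0 : 0 <= L by rewrite mulr_ge0// powR_ge0.
pose K := M * (1 + L) + C1 * D.
have K0 : 0 <= K by rewrite addr_ge0// mulr_ge0//; lra.
(* The added [1] makes the constant positive even when [K = 0]. *)
apply/eqO_exP; exists (1 + K); first by lra.
exists (N 0%N) => // n /= hn.
have [j /andP[jn nj]] := between_subsequence N_lt hn.
have ea := N_ge j; have a0 := expR1_gt0 ea.
have := Phi_next j; rewrite -/D; have := gap_le ea.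
have gw := gap_le_rate (ltW eps_gt0) ea.
have an : Phi (N j) <= Phi n by exact: Phi_homo.
have nb : Phi n <= Phi (N j.+1) by apply: Phi_homo; exact: ltnW.
have wn := le_rate (ltW eps_gt0) ea an.
have w0 := rate_gt0 eps ea.
have en1 := diff_le_of_incr (N_gt0 j) jn.
have en2 := diff_le_of_incr (leq_trans (N_gt0 j) jn) (ltnW nj).
move=> ga bD.
have wb : rate eps (Phi (N j.+1)) <= L * rate eps (Phi (N j)).
  apply: le_trans (rateM_le (ltW eps_gt0) c1 ea).
  apply: le_rate => //; first exact: ltW.
  rewrite /c; have := ler_wpM2l (le_trans ler01 D1) ga; lra.
have /ler_normlP[_ y2] := yM j.+1; have /ler_normlP[y1 _] := yM j.
have yn1 := y_homo _ _ jn; have yn2 := y_homo _ _ (ltnW nj).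
rewrite (ger0_norm (ltW (lt_le_trans w0 wn))).
set wa := rate eps (Phi (N j)) in w0 wn wb y1 gw.
have Mwb := ler_wpM2l M0 wb.
have diff : C1 * (Phi (N j.+1) - Phi (N j)) <= C1 * D * wa.
  rewrite -mulrA; apply: ler_wpM2l => //.
  have := ler_wpM2l (le_trans ler01 D1) gw; lra.
have d1 : C1 * (Phi n - Phi (N j)) <= C1 * (Phi (N j.+1) - Phi (N j)).
  by apply: ler_wpM2l => //; lra.
have d2 : C1 * (Phi (N j.+1) - Phi n) <= C1 * (Phi (N j.+1) - Phi (N j)).
  by apply: ler_wpM2l => //; lra.
apply: (@le_trans _ _ (K * wa)); last by apply: ler_pM => //; [exact: ltW|lra].
have Mw : 0 <= M * wa by exact: mulr_ge0 M0 (ltW w0).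
have MLw : 0 <= M * (L * wa) by apply: mulr_ge0 M0 _; exact: mulr_ge0 L0 (ltW w0).
by rewrite /K ler_norml; apply/andP; split; lra.
Qed.

End interpolation.

(** * Almost-everywhere boundedness from summable second moments *)

Section almost_everywhere.
Context d (X : measurableType d) (R : realType) (mu : probability X R).

(** The sum [Z] of all the squares has finite integral, so it is finite almost everywhere, and it
    dominates each single square. *)
Lemma ae_bounded_of_summable_sqr (Y : nat -> X -> R) (v : nat -> R) (C : R) :
  (forall j, measurable_fun setT (Y j)) ->
  (forall j, (\int[mu]_x ((Y j x) ^+ 2)%:E <= (v j)%:E)%E) ->
  (forall n, \sum_(0 <= j < n) v j <= C) ->
  {ae mu, forall x, exists M, forall j, `|Y j x| <= M}.
Proof.
move=> mY hv hC.
pose Z x := (\sum_(j <oo) ((Y j x) ^+ 2)%:E)%E.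
have mYE j : measurable_fun setT (fun x => ((Y j x) ^+ 2)%:E).
  exact/measurable_EFinP/measurable_funX.
have Y0 j x : (0 <= ((Y j x) ^+ 2)%:E)%E by rewrite lee_fin sqr_ge0.
have mZ : measurable_fun setT Z by exact: ge0_emeasurable_sum.
have Z0 x : (0 <= Z x)%E by exact: nneseries_ge0.
have ZC : (\int[mu]_x Z x <= C%:E)%E.
  rewrite integral_nneseries//; apply: lime_le.
    by apply: is_cvg_nneseries => j _ _; exact: integral_ge0.
  apply: nearW => n; apply: le_trans (_ : (\sum_(0 <= j < n) (v j)%:E <= _)%E).
    by apply: lee_sum.
  by rewrite sumEFin lee_fin.
have iZ : mu.-integrable setT Z.
  apply/integrableP; split => //.
  under eq_integral do rewrite gee0_abs//.
  exact: le_lt_trans ZC (ltry _).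
have [S [mS S0 SP]] := integrable_ae measurableT iZ.
exists S; split=> // x /= nx; apply: SP => /= Zfin; apply: nx.
have := Zfin I; rewrite ge0_fin_numE// => Zlt.
exists (1 + fine (Z x)) => j.
have : (((Y j x) ^+ 2)%:E <= Z x)%E.
  rewrite /Z (nneseriesD1 (n := j))// leeDl//; exact: nneseries_ge0.
rewrite -[Z x]fineK ?ge0_fin_numE// lee_fin => YZ.
(* This yields [|y| <= 1 + y ^+ 2], so no square root of [Z] is taken. *)
have : 0 <= (`|Y j x| - 1) ^+ 2 by exact: sqr_ge0.
rewrite sqrrB expr1n mulr1 real_normK ?num_real//.
have := sqr_ge0 (Y j x); have := normr_ge0 (Y j x); lra.
Qed.

End almost_everywhere.

(** * Partial sums of the functions and monotonicity of their moments *)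

Section psum.
Context (X : Type) (R : realType).
Variable f : nat -> X -> R.
Hypothesis f_ge0 : forall n, posnat n -> forall x, 0 <= f n x.

Definition psum (N : nat) (x : X) : R := \sum_(1 <= n < N.+1) f n x.

Lemma psumS N x : psum N.+1 x = psum N x + f N.+1 x.
Proof. by rewrite /psum big_nat_recr. Qed.

Lemma psum0 x : psum 0 x = 0.
Proof. by rewrite /psum big_geq. Qed.

Lemma psum_ge0 N x : 0 <= psum N x.
Proof.
elim: N => [|N IH]; first by rewrite psum0.
by rewrite psumS addr_ge0// f_ge0.
Qed.

Lemma psum_homo x : {homo psum^~ x : m n / (m <= n)%N >-> m <= n}.
Proof. by apply/nondecreasing_seqP => n; rewrite psumS lerDl f_ge0. Qed.

End psum.

Section partial_sums.
Context d (X : measurableType d) (R : realType) (mu : probability X R).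
Variables (g : nat -> R) (f : nat -> X -> R).
Hypotheses (f_ge0 : forall n, posnat n -> forall x, 0 <= f n x)
  (f_L2 : forall n, posnat n -> f n \in Lfun mu 2%:E)
  (g_ge0 : forall n, posnat n -> 0 <= g n).

Lemma psum_L2 N : psum f N \in Lfun mu 2%:E.
Proof.
elim: N => [|N IH].
  have -> : psum f 0 = cst 0 by apply/funext => x; rewrite psum0.
  exact: Lfun_cst.
have -> : psum f N.+1 = psum f N + f N.+1 by apply/funext => x; rewrite psumS.
have p1 : (1 <= 2%:E :> \bar R)%E by rewrite lee1n.
have [_ addL2] := Lfun_addr_closed mu p1.
by apply: addL2 => //; exact: f_L2.
Qed.

Lemma measurable_psum N : measurable_fun setT (psum f N).
Proof. by have := psum_L2 N; rewrite inE => /andP[/[!inE]]. Qed.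

Lemma integrable_psum N : mu.-integrable setT (EFin \o psum f N).
Proof.
apply/Lfun1_integrable/Lfun_subset12; last exact: psum_L2.
exact: fin_num_measure.
Qed.

Lemma integrable_psum_sqr N : mu.-integrable setT (fun x => ((psum f N x) ^+ 2)%:E).
Proof. exact: (Lfun2_integrable_sqr (psum_L2 N)). Qed.

(** [F1] is the real part of an extended integral, so finiteness has to be known; it follows from
    square integrability on a probability space. *)
Lemma integral_psum N : (\int[mu]_x (psum f N x)%:E = (F1 mu f N)%:E)%E.
Proof.
by rewrite fineK//; exact: integrable_fin_num (integrable_psum N).
Qed.

Lemma integral_psum_sqr N : (\int[mu]_x ((psum f N x) ^+ 2)%:E = (F2 mu f N)%:E)%E.
Proof.
by rewrite fineK//; exact: integrable_fin_num (integrable_psum_sqr N).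
Qed.

Lemma F1_ge0 N : 0 <= F1 mu f N.
Proof. by apply: Rintegral_ge0 => x _; exact: psum_ge0. Qed.

Lemma F2_ge0 N : 0 <= F2 mu f N.
Proof. by apply: Rintegral_ge0 => x _; exact: sqr_ge0. Qed.

Lemma G_ge0 N : 0 <= G g N.
Proof. by rewrite /G big_nat; apply: sumr_ge0 => i /andP[i0 _]; exact: g_ge0. Qed.

Lemma F1_homo : {homo F1 mu f : m n / (m <= n)%N >-> m <= n}.
Proof.
move=> m n mn; apply: le_Rintegral => //; try exact: integrable_psum.
by move=> x _; exact: psum_homo.
Qed.

Lemma F2_homo : {homo F2 mu f : m n / (m <= n)%N >-> m <= n}.
Proof.
move=> m n mn; apply: le_Rintegral => //; try exact: integrable_psum_sqr.
by move=> x _; apply: lerXn2r; rewrite ?nnegrE; [exact: psum_ge0..|exact: psum_homo].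
Qed.

Lemma G_homo : {homo G g : m n / (m <= n)%N >-> m <= n}.
Proof.
by apply/nondecreasing_seqP => n; rewrite /G [leRHS]big_nat_recr//= lerDl g_ge0.
Qed.

Lemma F3_homo : {homo F3 mu g f : m n / (m <= n)%N >-> m <= n}.
Proof.
move=> m n mn; rewrite /F3 lerD ?F2_homo// ler_pM ?sqr_ge0 ?addr_ge0 ?G_ge0//.
  by apply: lerXn2r; rewrite ?nnegrE ?F1_ge0// F1_homo.
by rewrite lerD ?ler_nat// G_homo.
Qed.

Lemma F3_unbounded n : 0 < F1 mu f n -> forall M, exists N, M <= F3 mu g f N.
Proof.
move=> Fn0 M; set q := F1 mu f n in Fn0.
pose k := Num.trunc (`|M| / q ^+ 2).
(* From [n] on [F1] is at least [q], so [F3] at an index [N >= n] is at least [N * q ^+ 2], and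
   [k.+1] exceeds [|M| / q ^+ 2]. *)
exists (maxn n k.+1).
have q2 : 0 < q ^+ 2 by exact: exprn_gt0.
have h1 : `|M| / q ^+ 2 <= k.+1%:R.
  exact/ltW/truncnS_gt.
have h2 : k.+1%:R <= (maxn n k.+1)%:R :> R by rewrite ler_nat leq_maxr.
have h3 : q ^+ 2 <= F1 mu f (maxn n k.+1) ^+ 2.
  by apply: lerXn2r; rewrite ?nnegrE ?F1_ge0//; apply: F1_homo; exact: leq_maxl.
rewrite (le_trans (ler_norm _))// -(divfK (lt0r_neq0 q2) `|M|) mulrC.
rewrite /F3 -[leLHS]addr0 lerD ?F2_ge0//; apply: ler_pM => //.
- exact: ltW.
- by rewrite divr_ge0// ltW.
- by have := G_ge0 (maxn n k.+1); lra.
Qed.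

End partial_sums.

(** * From the mixing hypothesis to the variance bound *)

(** Clearing denominators turns the [M] subtracted ones into [+ M]. When [B] or [C] is null both
    sides vanish, by monotonicity and, for [C], invariance of [mu]. *)
Lemma sum_correlation_le (R : realType) d (X : measurableType d)
    (mu : probability X R) (T : X -> X) (B C : set X) (M : nat) (gM : R) :
  measure_preserving mu T -> measurable B -> measurable C ->
  ((0 < mu B)%E -> (0 < mu C)%E ->
     \sum_(0 <= n < M)
        (fine (mu (B `&` iter n T @^-1` C)) / (fine (mu B) * fine (mu C)) - 1)
     <= gM) ->
  (\sum_(0 <= k < M) mu (B `&` iter k T @^-1` C) <=
     (gM + M%:R)%:E * (mu B * mu C))%E.
Proof.
move=> hT mB mC h.
have pT k := measure_preserving_iter hT k.
have mTC k : measurable (iter k T @^-1` C).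
  by rewrite -[X in measurable X]setTI; exact: (pT k).1.
have zero k : (mu B = 0 \/ mu C = 0 -> mu (B `&` iter k T @^-1` C) = 0)%E.
  move=> [B0|C0]; apply/eqP; rewrite -measure_le0 -?B0 -?C0.
    by apply: le_measure; rewrite ?inE//; exact: measurableI.
  rewrite -((pT k).2 C mC).
  by apply: le_measure; rewrite ?inE//; exact: measurableI.
have [B0|B0] := eqVneq (mu B) 0%E.
  by rewrite big1 ?B0 ?mul0e ?mule0// => k _; apply: zero; left.
have [C0|C0] := eqVneq (mu C) 0%E.
  by rewrite big1 ?C0 ?mule0// => k _; apply: zero; right.
have fB : (mu B = (fine (mu B))%:E)%E by rewrite fineK// fin_num_measure.
have fC : (mu C = (fine (mu C))%:E)%E by rewrite fineK// fin_num_measure.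
have B1 : (0 < mu B)%E by rewrite lt0e B0/=.
have C1 : (0 < mu C)%E by rewrite lt0e C0/=.
have {h} := h B1 C1; move: B1 C1.
under [X in _ -> _ -> _ -> (X <= _)%E]eq_bigr => k _.
  rewrite -(@fineK _ (mu (B `&` _)))//; last first.
    by rewrite fin_num_measure//; exact: measurableI.
  over.
rewrite fB fC /= !lte_fin sumEFin -!EFinM lee_fin => B1 C1.
have BC : 0 < fine (mu B) * fine (mu C) by exact: mulr_gt0.
rewrite sumrB -mulr_suml big_const_nat subn0 iter_addr_0 -ler_pdivrMr//; lra.
Qed.

Section second_moment.
Context d (X : measurableType d) (R : realType) (mu : probability X R).
Variables (T : X -> X) (A : nat -> set X) (g : nat -> R) (f : nat -> X -> R).
Hypotheses (hT : measure_preserving mu T) (hA : measurable_partition A)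
  (g_ge0 : forall n, posnat n -> 0 <= g n)
  (hmix : forall i j N : nat, posnat i -> posnat j -> posnat N ->
     (0 < mu (A i))%E -> (0 < mu (A j))%E ->
     \sum_(0 <= n < N.+1)
        (fine (mu (A i `&` iter n T @^-1` A j))
           / (fine (mu (A i)) * fine (mu (A j))) - 1) <= g N)
  (f_ge0 : forall n, posnat n -> forall x, 0 <= f n x)
  (f_L2 : forall n, posnat n -> f n \in Lfun mu 2%:E)
  (f_meas : forall n, posnat n -> partition_measurable A (f n)).

(** The parts are indexed from [1]; the shift to [A i.+1] makes them a family over all of [nat], as
    the step-function lemmas require. *)
Lemma psum_step N : exists c : nat -> R,
  (forall i, 0 <= c i) /\ forall i x, A i.+1 x -> psum f N x = c i.
Proof.
have ex_c i : exists v : R, 0 <= v /\ forall x, A i.+1 x -> psum f N x = v.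
  have [[z Az]|nA] := pselect (exists z, A i.+1 z); last first.
    (* An empty part offers no value to take; [0] keeps the constants nonnegative. *)
    by exists 0; split => // x Ax; exfalso; apply: nA; exists x.
  exists (psum f N z); split; first exact: psum_ge0.
  move=> x Ax; apply: eq_big_nat => n /andP[n0 _].
  exact: (partition_measurable_const hA (f_meas n0) (i := i.+1)).
by have [c cP] := choice ex_c; exists c; split => i; have [] := cP i.
Qed.

(** The mixing bound is available only from index [1] on. For [M = 0] the integrand is the square of
    the partial sum, which is the source of the term [F2] in [F3]. *)
Lemma integral_psum_mul_birkhoff_le N M :
  (\int[mu]_x (psum f N x * birkhoff T (psum f N) M.+1 x)%:E <=
   (if M is 0 then F2 mu f N else (g M + M.+1%:R) * F1 mu f N ^+ 2)%:E)%E.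
Proof.
have [mA tA cA] := hA.
case: M => [|M].
  rewrite -(integral_psum_sqr f_L2); apply: ge0_le_integral => //.
  - move=> x _; rewrite lee_fin mulr_ge0//; first exact: psum_ge0.
    by apply: birkhoff_ge0 => y; exact: psum_ge0.
  - apply/measurable_EFinP/measurable_funM; first exact: measurable_psum f_L2 _.
    apply: measurable_birkhoff hT _ _; exact: measurable_psum f_L2 _.
  - apply/measurable_EFinP/measurable_funX; exact: measurable_psum f_L2 _.
  - by move=> x _; rewrite /birkhoff big_nat1/= lee_fin expr2.
have [c [c0 hc]] := psum_step N.
apply: (@integral_mul_birkhoff_le _ _ _ mu T (fun i => A i.+1) c) => //.
- by move=> i; exact: mA.
- by move=> i j _ _ Aij; apply/succn_inj/tA.
- rewrite -cA; apply/seteqP; split => x [i]; first by move=> _ Ax; exists i.+1.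
  by case: i => // i _ Ax; exists i.
- exact: measurable_psum f_L2 _.
- by rewrite addr_ge0 ?g_ge0.
- exact: integral_psum f_L2 _.
- move=> i j; apply: sum_correlation_le => //; try exact: mA.
  by move=> Ai Aj; apply: hmix.
Qed.

Lemma sum_succ_double N :
  2 * \sum_(0 <= M < N) M.+1%:R = N%:R * (N%:R + 1) :> R.
Proof.
elim: N => [|N IH]; first by rewrite big_geq// mulr0 mul0r.
by rewrite big_nat_recr//= mulrDr IH -!natr1; ring.
Qed.

(** For [N >= 1], twice the sum of the bounds is [2 * F2 + 2 * F1 ^+ 2 * (G N - g N) + F1 ^+ 2 * (N
    * (N + 1) - 2)]. Subtracting [(N * F1) ^+ 2] cancels the term quadratic in [N], and what remains
    is at most [2 * F3]. *)
Lemma integral_birkhoff_psum_var_le N :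
  (\int[mu]_x ((birkhoff T (psum f N) N x - N%:R * F1 mu f N) ^+ 2)%:E <=
   (2 * F3 mu g f N)%:E)%E.
Proof.
have mP := measurable_psum f_L2 N; have P0 := psum_ge0 f_ge0 N.
have := integral_birkhoff_var_le hT mP P0 (integral_psum f_L2 N).
move=> /(_ _ (integral_psum_mul_birkhoff_le N) N) H; apply: le_trans H _.
rewrite lee_fin.
have q0 := F2_ge0 mu f N; have G0 := G_ge0 g_ge0 N.
have e0 := F1_ge0 mu f_ge0 N.
case: N {mP P0} q0 G0 e0 => [|N] q0 G0 e0.
  rewrite big_geq// /F3 /G big_geq//; have := sqr_ge0 (F1 mu f 0).
  lra.
rewrite big_nat_recl//= /F3.
set e := F1 _ _ _; set q := F2 _ _ _.
rewrite -mulr_suml big_split/=.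
have -> : \sum_(0 <= i < N) g i.+1 = G g N.+1 - g N.+1.
  by rewrite /G big_add1/= big_nat_recr//= addrK.
have := @sum_succ_double N.+1; rewrite big_nat_recl//=.
set S := \sum_(0 <= i < N) _ => SE.
have gN : 0 <= g N.+1 by exact: g_ge0.
have ge : 0 <= e ^+ 2 * g N.+1 by rewrite mulr_ge0 ?sqr_ge0.
have e2 : 0 <= e ^+ 2 by exact: sqr_ge0.
(* The [- 1] is the term at [M = 0] of the triangular sum, whose place is taken by [F2]. *)
have -> : S = (N.+1%:R * (N.+1%:R + 1)) / 2 - 1 by move: SE; lra.
have en : 0 <= e ^+ 2 * N.+1%:R by rewrite mulr_ge0.
lra.
Qed.

End second_moment.

(** * Summability along the subsequence and the conclusion *)

(** The bounds of [div_rate_sqr_le] telescope to a multiple of [psi 0 - psi n], which is at most [1]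
    because [ln (t 0) >= 1]. *)
Lemma sum_div_rate_sqr_le (R : realType) (eps : R) (t : nat -> R) : 0 < eps ->
  (forall j, expR 1 <= t j) -> (forall j, t j + gap (t j) <= t j.+1) ->
  forall n, \sum_(0 <= j < n) t j / rate eps (t j) ^+ 2 <=
    2 * 2 `^ (2 * eps) / eps.
Proof.
move=> e0 et tS n; set K := 2 * 2 `^ (2 * eps) / eps.
have K0 : 0 <= K by rewrite divr_ge0 ?mulr_ge0 ?powR_ge0 ?(ltW e0).
pose psi j := ln (t j) `^ (- (2 * eps)).
suff : \sum_(0 <= j < n) t j / rate eps (t j) ^+ 2 <= K * (psi 0%N - psi n).
  move=> /le_trans; apply; rewrite -[leRHS]mulr1; apply: ler_wpM2l => //.
  have psi1 : psi 0%N <= 1.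
    rewrite -(powRr0 (ln (t 0%N))); apply: ler_powR; first exact: ln_ge1.
    lra.
  have : 0 <= psi n by exact: powR_ge0.
  lra.
elim: n => [|n IH]; first by rewrite big_geq// subrr mulr0.
rewrite big_nat_recr//=.
have := div_rate_sqr_le e0 (et n) (tS n); rewrite -/K -/(psi n) -/(psi n.+1).
lra.
Qed.

Lemma ae_birkhoff_eq0 d (X : measurableType d) (R : realType)
    (mu : probability X R) (T : X -> X) (h : X -> R) (N : nat) :
  measure_preserving mu T -> measurable_fun setT h -> (forall x, 0 <= h x) ->
  (\int[mu]_x (h x)%:E = 0)%E -> {ae mu, forall x, birkhoff T h N x = 0}.
Proof.
move=> hT mh h0 ih.
have mB := measurable_birkhoff hT mh N.
have : (\int[mu]_x `|(birkhoff T h N x)%:E| = 0)%E.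
  under eq_integral do rewrite gee0_abs ?lee_fin ?birkhoff_ge0//.
  by rewrite (integral_birkhoff hT mh h0 N ih) mulr0.
have mBE : measurable_fun setT (fun x => (birkhoff T h N x)%:E).
  exact/measurable_EFinP.
move=> /(ae_eq_integral_abs mu measurableT mBE); apply: filterS => x /(_ I) /=.
by move=> [].
Qed.

(** Raising [N] adds both an iterate and a function, each contributing nonnegative terms. *)
Lemma birkhoff_psum_homo (R : realType) (X : Type) (T : X -> X)
    (f : nat -> X -> R) x :
  (forall n, posnat n -> forall x, 0 <= f n x) ->
  {homo (fun N => birkhoff T (psum f N) N x) : m n / (m <= n)%N >-> m <= n}.
Proof.
move=> f_ge0; apply/nondecreasing_seqP => n.
rewrite /birkhoff [leRHS]big_nat_recr//= -[leLHS]addr0 lerD ?psum_ge0//.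
by apply: ler_sum => k _; apply: psum_homo.
Qed.

Theorem theorem3 (R : realType) (d : measure_display) (X : measurableType d)
  (mu : probability X R) (T : X -> X) (A : nat -> set X)
  (g : nat -> R) (f : nat -> X -> R)
  (hT : measure_preserving mu T)
  (hA : measurable_partition A)
  (g_ge0 : forall n : nat, posnat n -> 0 <= g n)
  (g_o : g =o_\oo (fun N : nat => N%:R : R))
  (hmix : forall i j N : nat, posnat i -> posnat j -> posnat N ->
     (0 < mu (A i))%E -> (0 < mu (A j))%E ->
     \sum_(0 <= n < N.+1)
        (fine (mu (A i `&` iter n T @^-1` A j))
           / (fine (mu (A i)) * fine (mu (A j))) - 1) <= g N)
  (f_ge0 : forall n : nat, posnat n -> forall x : X, 0 <= f n x)
  (f_L2 : forall n : nat, posnat n -> f n \in Lfun mu 2%:E)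
  (f_meas : forall n : nat, posnat n -> partition_measurable A (f n))
  (hF1 : vinogradov
     (fun N => N.+1%:R * F1 mu f N.+1 - N%:R * F1 mu f N)
     (fun N => F3 mu g f N.+1 - F3 mu g f N))
  (hF3 : vinogradov
     (fun N => F3 mu g f N.+1 - F3 mu g f N)
     (fun N => F3 mu g f N `^ (2 / 3))) :
  forall eps : R, 0 < eps ->
  {ae mu, forall x : X,
     (fun N : nat =>
        \sum_(0 <= m < N) \sum_(1 <= n < N.+1) f n (iter m T x)
          - N%:R * F1 mu f N)
     =O_\oo
     (fun N : nat =>
        F3 mu g f N `^ (2 / 3) * ln (F3 mu g f N) `^ (1 / 3 + eps))}.
Proof.
move=> eps eps0.
have F3m := F3_homo f_ge0 f_L2 g_ge0.
have [[n1 n1F]|F1_eq0] := pselect (exists n, 0 < F1 mu f n); last first.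
  have F10 n : F1 mu f n = 0.
    apply/eqP; rewrite eq_le F1_ge0// andbT leNgt; apply/negP => h.
    by apply: F1_eq0; exists n.
  have : {ae mu, forall x N, birkhoff T (psum f N) N x = 0}.
    (* A countable union of null sets gives one exceptional set for all [N]. *)
    apply/ae_foralln => N; apply: ae_birkhoff_eq0 => //.
    - exact: measurable_psum f_L2 N.
    - exact: psum_ge0.
    - by rewrite (integral_psum f_L2) F10.
  apply: filterS => x Bx; apply/eqO_exP; exists 1 => //; apply: nearW => N.
  have := Bx N; rewrite /birkhoff /psum => ->.
  by rewrite F10 mulr0 subrr normr0 mul1r.
have F3_unb := F3_unbounded f_ge0 f_L2 g_ge0 n1F.
have [C1 hC1] := hF1; have [C2 hC2] := hF3.
have F3_incr n : 0 <= F3 mu g f n.+1 - F3 mu g f n by rewrite subr_ge0 F3m.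
have gap_gt0 (t : R) : expR 1 <= t -> 0 < gap t.
  move=> et; apply: mulr_gt0; apply: powR_gt0; first exact: expR1_gt0.
  exact: lt_le_trans ltr01 (ln_ge1 et).
have [S [S0 S_lt S_ge S_gap S_pred]] := sparse_subsequence F3m F3_unb gap_gt0.
pose t j := F3 mu g f (S j).
pose e N := N%:R * F1 mu f N.
(* The deviation in units of the target rate; by the variance bound its second moment is at most
   [2 * (t j / rate eps (t j) ^+ 2)], which is summable. *)
pose Y j x := (birkhoff T (psum f (S j)) (S j) x - e (S j)) / rate eps (t j).
have r0 j : 0 < rate eps (t j) by apply: rate_gt0; exact: S_ge.
have mB j : measurable_fun setT (birkhoff T (psum f (S j)) (S j)).
  by apply: measurable_birkhoff hT _ _; exact: measurable_psum f_L2 _.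
have : {ae mu, forall x, exists M, forall j, `|Y j x| <= M}.
  apply: (@ae_bounded_of_summable_sqr _ _ _ _ Y
    (fun j => 2 * (t j / rate eps (t j) ^+ 2)) (2 * (2 * 2 `^ (2 * eps) / eps))).
  - move=> j; apply: measurable_funM => //; exact: measurable_funB.
  - move=> j; have H := integral_birkhoff_psum_var_le hT hA g_ge0 hmix f_ge0 f_L2 f_meas (S j).
    under eq_integral do rewrite /Y exprMn mulrC EFinM.
    rewrite ge0_integralZl_EFin//; last 3 first.
    + by move=> x _; rewrite lee_fin sqr_ge0.
    + by apply/measurable_EFinP/measurable_funX; exact: measurable_funB.
    + exact: sqr_ge0.
    rewrite exprVn mulrA [X in (_ <= X%:E)%E]mulrC EFinM; apply: lee_wpmul2l H.
    by rewrite lee_fin invr_ge0 sqr_ge0.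
  - by move=> n; rewrite -mulr_sumr ler_wpM2l// sum_div_rate_sqr_le.
apply: filterS => x [M YM].
(* From here on [x] is fixed and the argument is deterministic. The constants [C1] and [C2] carry no
   sign, so their absolute values are used. *)
have e_incr n : (0 < n)%N ->
    `|e n.+1 - e n| <= `|C1| * (F3 mu g f n.+1 - F3 mu g f n).
  move=> n0; apply: le_trans (hC1 n n0) _.
  by apply: ler_wpM2r => //; exact: ler_norm.
have F3_incr' n : (0 < n)%N ->
    F3 mu g f n.+1 - F3 mu g f n <= `|C2| * F3 mu g f n `^ (2 / 3).
  move=> n0; apply: le_trans (ler_norm _) _; apply: le_trans (hC2 n n0) _.
  by apply: ler_wpM2r; [exact: powR_ge0|exact: ler_norm].
apply: (interpolation_bigO F3m eps0 (normr_ge0 C1) (normr_ge0 C2) e_incr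
  F3_incr' S0 S_lt S_ge S_pred (y := fun N => birkhoff T (psum f N) N x) (M := M)).
  exact: birkhoff_psum_homo.
move=> j; have := YM j; rewrite /Y normrM normfV (gtr0_norm (r0 j)).
by rewrite ler_pdivrMr.
Qed.
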